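(* Let $(V,\Omega)$ be a symplectic vector space with canonical Liouville form $\theta$, given by $\theta_z(v_z)=\frac12\Omega(z,v)$ for $z,v\in V$. Let $n$ be a positive integer. For $a\in V$ let $\psi^a(z)=\frac{1}{2(n+2)}\Omega(a,z)^{n+2}$, let $\theta^a=\theta+{\rm d}\psi^a$, and let $f_a:V\to V$ be the diffeomorphism $f_a(z)=z+\frac1n\Omega(a,z)^{n+1}a$. Then for all $a,b\in V$, $${\rm Iso}(V^a,V^b)=\{f_b\circ\gamma\circ f_a^{-1}:\gamma\in{\rm Sp}(V,\Omega)\},$$ where ${\rm Iso}(V^a,V^b)$ is the set of all smooth maps $g:V\to V$ such that $g^*\theta^b=\theta^a$.
   Context: A symplectic vector space $(V,\Omega)$ is a finite-dimensional real vector space $V$ with a nonsingular alternating bilinear form $\Omega$. Regard $V$ as a smooth manifold; for $z,v\in V$ let $v_z\in T_zV$ be the tangent vector given by $v_z\psi=\frac{\rm d}{{\rm d}t}\psi(z+tv)|_{t=0}$ for smooth $\psi:V\to\mathbb{R}$. ${\rm Sp}(V,\Omega)$ is the group of linear automorphisms $g$ of $V$ with $\Omega(gx,gy)=\Omega(x,y)$ for all $x,y\in V$. The inverse of $f_a$ is $z\mapsto z-\frac1n\Omega(a,z)^{n+1}a$. *)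

(* Defs.v *)
From HB Require Import structures.
From mathcomp Require Import all_boot all_order all_algebra.
From mathcomp Require Import all_classical all_reals all_analysis.

Set Implicit Arguments.
Unset Strict Implicit.
Unset Printing Implicit Defensive.

Import Order.TTheory GRing.Theory Num.Theory.
Import numFieldNormedType.Exports.
Import VectorInternalTheory.

Local Open Scope classical_set_scope.
Local Open Scope ring_scope.

(* f is of class C^k. Applied below to maps between the finite-dimensional
   spaces 'rV[R]_m only, where it is the usual notion. *)
Fixpoint Ck (R : realType) (E F : normedModType R) (k : nat) (f : E -> F)
    : Prop :=
  if k is k'.+1 then
    (forall x, differentiable f x) /\ (forall v, Ck k' ('D_v f))
  else continuous f.

Section SymplecticVectorSpace.
Context {R : realType} {V : vectType R}.

(* A vectType carries no topology; its smooth structure is the one for which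
   the linear isomorphism v2r : V -> 'rV[R]_(dim V), with inverse r2v, is a
   global chart. Another linear isomorphism gives the same structure. *)
Definition smooth (g : V -> V) : Prop :=
  forall k, Ck k (fun x : 'rV[R]_(dim V) => v2r (g (r2v x))).

(* T_z V is identified with V by v |-> v_z, so a 1-form eta on V has type
   V -> V -> R, and eta z v stands for eta_z(v_z). *)

(* (d psi)_z(v_z) = v_z psi *)
Definition differential (psi : V -> R) (z v : V) : R :=
  derive1 (fun t : R => psi (z + t *: v)) 0.

(* The w such that T_z g maps v_z to w_(g z), that is
   w = d/dt g(z + t v) at t = 0, the limit being taken in the chart v2r. *)
Definition tangent_map (g : V -> V) (z v : V) : V :=
  r2v (derive1 (fun t : R => v2r (g (z + t *: v))) 0).

Definition pullback (g : V -> V) (eta : V -> V -> R) (z v : V) : R :=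
  eta (g z) (tangent_map g z v).

Definition Iso (eta1 eta2 : V -> V -> R) : set (V -> V) :=
  [set g | smooth g /\ pullback g eta2 = eta1].

Definition symplectic (Omega : {biscalar V}) : Prop :=
  (forall x, Omega x x = 0) /\
  (forall x, (forall y, Omega x y = 0) -> x = 0).

Definition Sp (Omega : {biscalar V}) : set (V -> V) :=
  [set g | [/\ linear g, bijective g &
               forall x y, Omega (g x) (g y) = Omega x y]].

Definition liouville (Omega : {biscalar V}) (z v : V) : R :=
  2^-1 * Omega z v.

Definition psi (Omega : {biscalar V}) (n : nat) (a z : V) : R :=
  (2 * n.+2%:R)^-1 * Omega a z ^+ n.+2.

Definition liouville_at (Omega : {biscalar V}) (n : nat) (a z v : V) : R :=
  liouville Omega z v + differential (psi Omega n a) z v.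

Definition shear (Omega : {biscalar V}) (n : nat) (a z : V) : V :=
  z + (n%:R^-1 * Omega a z ^+ n.+1) *: a.

Definition shear_inv (Omega : {biscalar V}) (n : nat) (a z : V) : V :=
  z - (n%:R^-1 * Omega a z ^+ n.+1) *: a.

Lemma shearK (Omega : {biscalar V}) (n : nat) (a : V) :
  symplectic Omega -> cancel (shear Omega n a) (shear_inv Omega n a).
Proof.
move=> [alt _] z; rewrite /shear_inv /shear.
by rewrite linearDr linearZr /= alt mulr0 addr0 addrK.
Qed.

Lemma shear_invK (Omega : {biscalar V}) (n : nat) (a : V) :
  symplectic Omega -> cancel (shear_inv Omega n a) (shear Omega n a).
Proof.
move=> [alt _] z; rewrite /shear_inv /shear.
by rewrite linearBr linearZr /= alt mulr0 subr0 subrK.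
Qed.

End SymplecticVectorSpace.

(* Main.v *)
Require Import Defs.
From HB Require Import structures.
From mathcomp Require Import all_boot all_order all_algebra.
From mathcomp Require Import all_classical all_reals all_analysis.
From mathcomp Require Import ring lra.

(** The shear [f_a] satisfies [f_a^* theta = theta - d psi^a], because the two
    contributions of the degree n+1 perturbation to [theta] have coefficients
    -(n+1)/n and 1/n; since [psi^a] is [f_a]-invariant, [f_a^* theta^a = theta]
    ([Iso_shear]), and likewise [f_a^{-1}] carries [theta] back to [theta^a]
    ([Iso_shear_inv]).  Isomorphisms compose ([Iso_comp]), so that conjugation
    by the shears reduces the theorem to [Iso(V, V) = Sp(V, Omega)]
    ([Iso_liouville]).

    A linear symplectic map preserves [theta].  Conversely, let a smooth [g]
    satisfy [Omega(g z, Dg_z v) = Omega(z, v)].  Differentiating once more and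
    antisymmetrizing, which eliminates the second derivatives because they are
    symmetric ([derive_commute]), gives
    [Omega(Dg_z u, Dg_z v) = Omega(u, v)] ([derive_isometry]): this is
    [g^* Omega = Omega].  Thus [Dg_z] is invertible, and comparing both
    identities gives [Dg_z z = g z] ([derive_radial]), that is, [g] preserves the Euler
    vector field.  Hence [g] is homogeneous of degree one, and since it is
    differentiable at 0 it is equal to its derivative there
    ([Euler_homogeneous]), which is linear and symplectic.

    The calculus takes place in the chart [v2r], on row vectors. *)

Set Implicit Arguments.
Unset Strict Implicit.
Unset Printing Implicit Defensive.

Import Order.TTheory GRing.Theory Num.Theory.
Import numFieldNormedType.Exports.
Import VectorInternalTheory.

Local Open Scope classical_set_scope.
Local Open Scope ring_scope.

(** * Calculus of maps of class C^k *)

Section Leibniz.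
Context {R : realType} {E F1 F2 F : normedModType R} {B : F1 -> F2 -> F}.
Hypothesis Bbil : bilinear_for (GRing.Scale.Law.clone _ _ *:%R _)
  (GRing.Scale.Law.clone _ _ *:%R _) B.
Hypothesis Bcont : continuous (fun p : F1 * F2 => B p.1 p.2).
Implicit Types (f : E -> F1) (g : E -> F2) (x : E).

Let BL : {bilinear F1 -> F2 -> F} :=
  HB.pack B (bilinear_isBilinear.Build R F1 F2 F _ _ B Bbil).

Lemma differentiable_bilinear f g x :
  differentiable f x -> differentiable g x ->
  differentiable (fun y => B (f y) (g y)) x.
Proof.
move=> df dg.
apply: (@differentiable_comp _ _ _ _ (fun y => (f y, g y))
  (fun p : F1 * F2 => BL p.1 p.2)); first exact: differentiable_pair.
exact: (@differentiable_bilin _ _ _ _ BL).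
Qed.

Lemma derive_bilinear f g x v :
  differentiable f x -> differentiable g x ->
  'D_v (fun y => B (f y) (g y)) x = B (f x) ('D_v g x) + B ('D_v f x) (g x).
Proof.
move=> df dg; rewrite !deriveE//; last exact: differentiable_bilinear.
rewrite (@diff_comp _ _ _ _ (fun y => (f y, g y))
  (fun p : F1 * F2 => BL p.1 p.2)) /=; last 2 first.
- exact: differentiable_pair.
- exact: (@differentiable_bilin _ _ _ _ BL).
by rewrite (@diff_bilin _ _ _ _ BL)// diff_pair.
Qed.

End Leibniz.

Lemma scale_bilinear {R : realType} (F : normedModType R) :
  bilinear_for (GRing.Scale.Law.clone _ _ *:%R _)
    (GRing.Scale.Law.clone _ _ *:%R _) (@GRing.scale R F : R -> F -> F).
Proof.
split=> [u'|u] a x y /=; first by rewrite scalerDl -scalerA.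
by rewrite scalerDr !scalerA mulrC.
Qed.

(** Writing [L] in the standard basis reduces its continuity to that of the
    coordinates. *)
Lemma linear_row_continuous {R : realType} m (F : normedModType R)
  (L : 'rV[R]_m -> F) : linear L -> continuous L.
Proof.
move=> linL.
pose LL : {linear 'rV[R]_m -> F} :=
  HB.pack L (GRing.isLinear.Build _ _ _ _ L linL).
have -> : L = fun x => \sum_(i < m) x 0 i *: L (delta_mx 0 i).
  apply/funext => x; rewrite -[L]/(LL : _ -> _) {1}(row_sum_delta x) linear_sum.
  by apply: eq_bigr => i _; rewrite linearZ.
move=> x; apply: (@cvg_big _ _ _ _ _ (@add_continuous F) _ (nbhs x)) => i _.
by apply: cvgZr_tmp; exact: coord_continuous.
Qed.

Lemma linear_row_differentiable {R : realType} m (F : normedModType R)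
  (L : 'rV[R]_m -> F) x : linear L -> differentiable L x.
Proof.
move=> linL.
pose LL : {linear 'rV[R]_m -> F} :=
  HB.pack L (GRing.isLinear.Build _ _ _ _ L linL).
exact: (@linear_differentiable _ _ _ LL x (linear_row_continuous linL)).
Qed.

Lemma derive_linear_row {R : realType} m (F : normedModType R)
  (L : 'rV[R]_m -> F) x v : linear L -> 'D_v L x = L v.
Proof.
move=> linL.
pose LL : {linear 'rV[R]_m -> F} :=
  HB.pack L (GRing.isLinear.Build _ _ _ _ L linL).
rewrite deriveE; last exact: linear_row_differentiable.
by rewrite (@diff_lin _ _ _ LL x (linear_row_continuous linL)).
Qed.

Section CkCalculus.
Context {R : realType} {E : normedModType R}.
Implicit Types F : normedModType R.

Lemma CkW F k (f : E -> F) : Ck k.+1 f -> Ck k f.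
Proof.
elim: k f => [|k IHk] f /= [df Ddf].
  by move=> x; exact: differentiable_continuous.
by split=> // v; exact: IHk.
Qed.

Lemma Ck_cst F k (c : F) : Ck k (fun _ : E => c).
Proof.
elim: k c => [|k IHk] c /=; first by move=> x; exact: cst_continuous.
split=> [x|v]; first exact: differentiable_cst.
have -> : 'D_v (fun=> c) = fun _ : E => 0 :> F.
  by apply/funext => x; rewrite derive_cst.
exact: IHk.
Qed.

Lemma CkD F k (f g : E -> F) : Ck k f -> Ck k g -> Ck k (fun x => f x + g x).
Proof.
elim: k f g => [|k IHk] f g /=.
  by move=> cf cg x; exact: cvgD (cf x) (cg x).
move=> [df Df] [dg Dg]; split=> [x|v]; first exact: differentiableD.
have -> : 'D_v (fun x => f x + g x) = fun x => 'D_v f x + 'D_v g x.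
  by apply/funext => x; rewrite deriveD//; exact: diff_derivable.
by apply: IHk.
Qed.

(** The Leibniz rule expresses the derivatives of [B (f x) (g x)] by values of
    [B] at derivatives of [f] and [g], whence an induction on k. *)
Lemma Ck_bilinear (F1 F2 F : normedModType R) (B : F1 -> F2 -> F) :
  bilinear_for (GRing.Scale.Law.clone _ _ *:%R _)
    (GRing.Scale.Law.clone _ _ *:%R _) B ->
  continuous (fun p : F1 * F2 => B p.1 p.2) ->
  forall k (f : E -> F1) (g : E -> F2),
  Ck k f -> Ck k g -> Ck k (fun x => B (f x) (g x)).
Proof.
move=> Bbil Bcont; elim=> [|k IHk] f g.
  move=> cf cg x.
  apply: (@continuous_comp _ _ _ (fun y => (f y, g y)) (fun p => B p.1 p.2));
    last exact: Bcont.
  by apply: cvg_pair; [exact: cf|exact: cg].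
move=> Cf Cg; have [[df Df] [dg Dg]] := (Cf, Cg).
split=> [x|v]; first exact: differentiable_bilinear.
have -> : 'D_v (fun x => B (f x) (g x)) =
    fun x => B (f x) ('D_v g x) + B ('D_v f x) (g x).
  by apply/funext => x; rewrite derive_bilinear.
apply: CkD.
  by apply: (IHk f ('D_v g)); [exact: CkW|exact: Dg].
by apply: (IHk ('D_v f) g); [exact: Df|exact: CkW].
Qed.

Lemma CkZ F k (f : E -> R) (g : E -> F) :
  Ck k f -> Ck k g -> Ck k (fun x => f x *: g x).
Proof.
apply: (Ck_bilinear (@scale_bilinear R F)).
exact: scale_continuous.
Qed.

Lemma CkX k n (f : E -> R) : Ck k f -> Ck k (fun x => f x ^+ n).
Proof.
move=> Cf; elim: n => [|n IHn].
  by under eq_fun do rewrite expr0; exact: Ck_cst.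
by under eq_fun do rewrite exprS; exact: CkZ.
Qed.

End CkCalculus.

Lemma Ck_sum {R : realType} (E F : normedModType R) k m (f : 'I_m -> E -> F) :
  (forall i, Ck k (f i)) -> Ck k (fun x => \sum_i f i x).
Proof.
elim: m f => [|m IHm] f Cf.
  by under eq_fun do rewrite big_ord0; exact: Ck_cst.
under eq_fun do rewrite big_ord_recl.
by apply: CkD => //; exact: IHm.
Qed.

Lemma Ck_linear_row {R : realType} m (F : normedModType R)
  (L : 'rV[R]_m -> F) k : linear L -> Ck k L.
Proof.
case: k => [|k] linL; first exact: linear_row_continuous.
split=> [x|v]; first exact: linear_row_differentiable.
have -> : 'D_v L = fun=> L v by apply/funext => x; exact: derive_linear_row.
exact: Ck_cst.
Qed.

Lemma Ck_coord {R : realType} (E : normedModType R) k m (f : E -> 'rV[R]_m) i j :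
  Ck k f -> Ck k (fun x => f x i j).
Proof.
elim: k f => [|k IHk] f.
  move=> cf x.
  apply: (@continuous_comp _ _ _ f (fun M : 'rV[R]_m => M i j)); first exact: cf.
  exact: coord_continuous.
move=> [df Df]; split=> [x|v].
  apply: (@differentiable_comp _ _ _ _ f (fun M : 'rV[R]_m => M i j)) => //.
  exact: differentiable_coord.
have -> : 'D_v (fun x => f x i j) = fun x => 'D_v f x i j.
  apply/funext => x; rewrite derive_mx ?mxE//; exact: diff_derivable.
exact: (IHk ('D_v f) (Df v)).
Qed.

Lemma derive_comp {R : realType} (E F G : normedModType R)
  (g : F -> G) (f : E -> F) x v :
  differentiable f x -> differentiable g (f x) ->
  'D_v (g \o f) x = 'D_('D_v f x) g (f x).
Proof.
move=> df dg; rewrite !deriveE//; last exact: differentiable_comp.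
by rewrite diff_comp.
Qed.

(** The source of [g] has to be a space of row vectors: the chain rule expands
    [D_v (g \o f)] along the standard basis, into sums and products of C^k maps,
    and the induction on k applies to the partial derivatives of [g]. *)
Lemma Ck_comp {R : realType} (E F : normedModType R) m k
  (g : 'rV[R]_m -> F) (f : E -> 'rV[R]_m) :
  Ck k g -> Ck k f -> Ck k (g \o f).
Proof.
elim: k g => [|k IHk] g.
  by move=> cg cf x; apply: continuous_comp; [exact: cf|exact: cg].
move=> [dg Dg] Cf; have [df Df] := Cf.
split=> [x|v]; first exact: differentiable_comp.
have -> : 'D_v (g \o f) =
    fun x => \sum_i 'D_v f x 0 i *: ('D_(delta_mx 0 i) g \o f) x.
  apply/funext => x; rewrite derive_comp//= [LHS]deriveE//.
  rewrite {1}(row_sum_delta ('D_v f x)) linear_sum; apply: eq_bigr => i _.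
  by rewrite linearZ /= -deriveE.
apply: Ck_sum => i; apply: CkZ; first exact: (Ck_coord 0 i (Df v)).
exact: (IHk _ (Dg _) (CkW Cf)).
Qed.

(** * Symmetry of second derivatives *)

Lemma is_derive_line {R : realType} (E F : normedModType R) (f : E -> F)
  x v t : differentiable f (x + t *: v) ->
  is_derive t 1 (fun s : R => f (x + s *: v)) ('D_v f (x + t *: v)).
Proof.
move=> /diff_derivable df.
have eq_quotient : (fun h : R => h^-1 *: (((fun s => f (x + s *: v)) \o shift t)
      (h *: (1 : R)) - f (x + t *: v))) =
    fun h : R => h^-1 *: ((f \o shift (x + t *: v)) (h *: v) - f (x + t *: v)).
  apply/funext => h; rewrite /= [h *: 1]mulr1 scalerDl.
  by rewrite addrCA.
by split; [rewrite /derivable|rewrite /derive]; rewrite eq_quotient//; apply: df.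
Qed.

Lemma MVT_line {R : realType} (E : normedModType R) (f : E -> R) x v (h : R) :
  0 < h -> (forall y, differentiable f y) ->
  exists2 t, 0 < t < h & f (x + h *: v) - f x = h * 'D_v f (x + t *: v).
Proof.
move=> h0 df.
have dl t := is_derive_line (df (x + t *: v)).
have [|t] := @MVT R _ _ 0 h h0 (fun t _ => dl t).
  apply: continuous_subspaceT => t; apply: differentiable_continuous.
  exact/derivable1_diffP.
by rewrite in_itv /= scale0r addr0 subr0 mulrC => th e; exists t.
Qed.

Definition second_difference {R : realType} (E : normedModType R) (f : E -> R)
    (x u v : E) (h : R) : R :=
  f (x + h *: u + h *: v) - f (x + h *: u) - (f (x + h *: v) - f x).

Lemma second_differenceC {R : realType} (E : normedModType R) (f : E -> R) x u v :
  second_difference f x u v = second_difference f x v u.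
Proof.
apply/funext => h; rewrite /second_difference (addrAC x (h *: v)) !opprB.
by rewrite addrACA [RHS]addrACA; congr (_ + _); exact: addrC.
Qed.

(** The mean value theorem applies first in the direction [u] to
    [y |-> f (y + h v) - f y], whose derivative is a difference of values of
    [D_u f], and then in the direction [v] to [D_u f]. *)
Lemma second_difference_MVT {R : realType} (E : normedModType R) (f : E -> R)
  x u v (h : R) : 0 < h -> (forall y, differentiable f y) ->
  (forall y, differentiable ('D_u f) y) ->
  exists s t, [/\ 0 < s < h, 0 < t < h &
    second_difference f x u v h = h ^+ 2 * 'D_v ('D_u f) (x + s *: u + t *: v)].
Proof.
move=> h0 df ddf.
pose g y := f (y + h *: v) - f y.
have dfh y : differentiable (fun y => f (y + h *: v)) y.
  by apply: (@differentiable_comp _ _ _ _ (fun y => y + h *: v) f).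
have dg y : differentiable g y by apply: differentiableB.
have [s sh gE] := MVT_line x u h0 dg.
have Dg y : 'D_u g y = 'D_u f (y + h *: v) - 'D_u f y.
  rewrite deriveB; [|exact: diff_derivable|exact: diff_derivable].
  rewrite (_ : 'D_u (fun z => f (z + h *: v)) y = 'D_u f (y + h *: v))//.
  rewrite (@derive_comp _ _ _ _ f (fun z => z + h *: v))//.
  by rewrite deriveD// derive_cst derive_id addr0.
have [t th DgE] := MVT_line (x + s *: u) v h0 ddf.
exists s, t; split => //; rewrite expr2 -mulrA -DgE -Dg -gE /g.
by rewrite /second_difference; congr (_ - _).
Qed.

Lemma second_difference_cvg {R : realType} (E : normedModType R) (f : E -> R)
  x u v : Ck 2 f ->
  h ^- 2 * second_difference f x u v h @[h --> 0^'+] --> 'D_v ('D_u f) x.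
Proof.
move=> [df Ddf]; have [ddf /(_ v)] := Ddf u; set A := 'D_v ('D_u f) => cA.
pose p (q : R * R) := x + q.1 *: u + q.2 *: v.
have cp : {for (0, 0), continuous p}.
  apply: cvgD; last by apply: cvgZr_tmp; exact: cvg_snd.
  by apply: cvgD; [exact: cvg_cst|apply: cvgZr_tmp; exact: cvg_fst].
have : {for (0, 0), continuous (A \o p)}.
  by apply: continuous_comp => //; exact: cA.
move=> /cvgrPdist_lt cAp; apply/cvgrPdist_lt => e e0.
have /nbhs_ballP[d /= d0 pd] := cAp e e0.
near=> h; have h0 : 0 < h by near: h; exact: nbhs_right_gt.
have hd : h < d by near: h; exact: nbhs_right_lt.
have [s [t [/andP[s0 sh] /andP[t0 th] ->]]] :=
  second_difference_MVT x v h0 df ddf.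
rewrite mulKf ?expf_neq0 ?gt_eqF//.
have := pd (s, t); rewrite /p /= !scale0r !addr0; apply.
by split; rewrite /= /ball /= sub0r normrN gtr0_norm// (lt_trans _ hd).
Unshelve. all: by end_near. Qed.

(** Both iterated derivatives are the limit of the same difference quotient,
    since the second difference is symmetric in [u] and [v]. *)
Lemma derive_commute {R : realType} (E : normedModType R) (f : E -> R) u v x :
  Ck 2 f -> 'D_v ('D_u f) x = 'D_u ('D_v f) x.
Proof.
move=> Cf; have cvg_vu := @second_difference_cvg _ _ _ x v u Cf.
rewrite second_differenceC in cvg_vu.
have cvg_uv := @second_difference_cvg _ _ _ x u v Cf.
have := cvg_unique (@norm_hausdorff _ _) cvg_uv cvg_vu; apply.
Qed.

(** * Homogeneous functions of degree one *)

(** By the Euler identity [f (t x) / t] has derivative zero for t > 0, so it is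
    constant.  Its value at t = 1 is [f x], and its limit at 0 is [D_x f 0],
    because the identity at 0 gives [f 0 = 0]. *)
Lemma Euler_homogeneous {R : realType} (E : normedModType R) (f : E -> R) :
  (forall x, differentiable f x) -> (forall x, 'D_x f x = f x) ->
  forall x, f x = 'D_x f 0.
Proof.
move=> df Ef x.
pose phi (t : R) := t^-1 * f (t *: x).
have dl (t : R) : is_derive t 1 (fun s : R => f (s *: x)) ('D_x f (t *: x)).
  have := @is_derive_line _ _ _ f 0 x t (df _); rewrite add0r.
  by under eq_fun do rewrite add0r.
have dphi (t : R) : 0 < t -> is_derive t 1 phi 0.
  move=> t0; have tN0 : t != 0 by rewrite gt_eqF.
  have Et : t * 'D_x f (t *: x) = f (t *: x).
    by rewrite -[RHS]Ef [RHS]deriveE// linearZ /= -deriveE.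
  have dinv := is_deriveV tN0 (is_derive_id t 1).
  apply: is_derive_eq (is_deriveM dinv (dl t)) _.
  rewrite -Et; move: ('D_x f (t *: x)) => D; rewrite /GRing.scale /=.
  by field.
have phi_cst (t : R) : 0 < t < 1 -> phi t = f x.
  move=> /andP[t0 t1]; have [||s _] := @MVT R phi (fun=> 0) t 1 t1.
  + by move=> s; rewrite in_itv /= => /andP[ts _]; apply/dphi/(lt_trans t0).
  + apply: derivable_within_continuous => s; rewrite in_itv /= => /andP[ts _].
    by have [] := dphi s (lt_le_trans t0 ts).
  + by rewrite mul0r /phi invr1 scale1r mul1r => /eqP; rewrite subr_eq0 => /eqP.
have f0 : f 0 = 0 by rewrite -Ef derive0.
have cvg1 : phi t @[t --> 0^'+] --> 'D_x f 0.
  apply: cvg_dnbhs_at_right.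
  have : derivable f 0 x by exact: diff_derivable.
  by rewrite /derivable /derive /= f0; under eq_fun do rewrite addr0 subr0.
have cvg2 : phi t @[t --> 0^'+] --> f x.
  apply: (@cvg_near_cst).
  near=> t; apply: phi_cst; apply/andP; split; near: t.
    exact: nbhs_right_gt.
  exact: nbhs_right_lt.
exact: (cvg_unique (@norm_hausdorff _ _) cvg2 cvg1).
Unshelve. all: by end_near. Qed.

(** * Rigidity of maps preserving the Liouville form *)

Lemma alternating_skew {R : realType} (V : lmodType R) (B : {biscalar V}) :
  (forall x, B x x = 0) -> forall x y, B y x = - B x y.
Proof.
move=> alt x y; apply/eqP; rewrite -addr_eq0 -(alt (x + y)).
by rewrite linearDl !linearDr /= !alt add0r addr0 addrC.
Qed.

Section RowSpace.
Context {R : realType} {m : nat} {B : {biscalar 'rV[R]_m}}.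
Local Notation E := 'rV[R]_m.

Lemma biscalar_bilinear : bilinear_for (GRing.Scale.Law.clone _ _ *:%R _)
  (GRing.Scale.Law.clone _ _ *:%R _) (B : E -> E -> R).
Proof. by split=> [u'|u] a x y; rewrite (linearPl, linearPr). Qed.

Lemma biscalar_row_continuous : continuous (fun p : E * E => B p.1 p.2 : R).
Proof.
have -> : (fun p : E * E => B p.1 p.2 : R) =
    fun p : E * E => \sum_i p.1 0 i * B (delta_mx 0 i) p.2.
  apply/funext => p; rewrite {1}(row_sum_delta p.1) linear_sumlz.
  by apply: eq_bigr => i _; rewrite linearZl.
move=> p; apply: (@cvg_big _ _ _ _ _ (@add_continuous R) _ (nbhs p)) => i _.
apply: cvgM.
  apply: (@continuous_comp _ _ _ fst (fun x : E => x 0 i)); first exact: cvg_fst.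
  exact: coord_continuous.
apply: (@continuous_comp _ _ _ snd (B (delta_mx 0 i))); first exact: cvg_snd.
by apply: linear_row_continuous => k x y; rewrite linearPr.
Qed.

(** Nondegeneracy makes [L] injective, and the dimension is finite. *)
Lemma isometry_bijective (L : {linear E -> E}) :
  (forall x, (forall y, B x y = 0) -> x = 0) ->
  (forall x y, B (L x) (L y) = B x y) -> bijective L.
Proof.
move=> nondeg iso.
have injL : injective L.
  apply: raddf_inj => x Lx0; apply: nondeg => y.
  by rewrite -iso Lx0 linear0l.
have unitL : lin1_mx L \in unitmx.
  rewrite -row_free_unit; apply/inj_row_free => x.
  by rewrite mul_rV_lin1 => Lx0; apply: injL; rewrite Lx0 linear0.
exists (mulmx^~ (invmx (lin1_mx L))) => x; first by rewrite -mul_rV_lin1 mulmxK.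
by rewrite -mul_rV_lin1 mulmxKV.
Qed.

(** Symmetry of second derivatives, applied to each coordinate of [G]. *)
Lemma derive_commute_row (G : E -> E) u v x :
  Ck 2 G -> 'D_v ('D_u G) x = 'D_u ('D_v G) x.
Proof.
move=> CG; have [dG DG] := CG.
have coordE w w' j : 'D_w' ('D_w G) x 0 j = 'D_w' ('D_w (fun y => G y 0 j)) x.
  rewrite derive_mx ?mxE; last by apply: diff_derivable; case: (DG w).
  congr ('D_w' _ x); apply/funext => y.
  by rewrite derive_mx ?mxE//; exact: diff_derivable.
apply/rowP => j; apply: etrans (coordE u v j) (etrans _ (esym (coordE v u j))).
exact: (@derive_commute R E (fun y => G y 0 j) u v x (Ck_coord 0 j CG)).
Qed.

Section Rigidity.
Hypothesis alt : forall x, B x x = 0.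
Hypothesis nondeg : forall x, (forall y, B x y = 0) -> x = 0.
Context {G : E -> E}.
Hypothesis CG : Ck 2 G.
Hypothesis GB : forall x v, B (G x) ('D_v G x) = B x v.

Let dG x : differentiable G x. Proof. by case: CG. Qed.

(** The derivative of [B (G x) (D_v G x) = B x v] in the direction [u], minus the
    same identity with [u] and [v] exchanged: the terms in the second derivatives
    of [G] cancel, and skew-symmetry doubles the others.  This is the exterior
    derivative of the hypothesis. *)
Lemma derive_isometry x u v : B ('D_u G x) ('D_v G x) = B u v.
Proof.
(* Both sides are the derivative in the direction [w] of
   [y |-> B (G y) (D_w' G y) = B y w']. *)
have E1 w w' : B (G x) ('D_w ('D_w' G) x) + B ('D_w G x) ('D_w' G x) = B w w'.
  rewrite -(derive_bilinear biscalar_bilinear biscalar_row_continuous)//;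
    last by case: CG => _ /(_ w')[].
  under eq_fun do rewrite GB.
  rewrite (derive_bilinear biscalar_bilinear biscalar_row_continuous)//.
  by rewrite derive_cst derive_id linear0r add0r.
have := E1 u v; have := E1 v u.
rewrite derive_commute_row// (alternating_skew alt ('D_u G x)).
rewrite (alternating_skew alt u); lra.
Qed.

(** Against any [D_y G x], both [D_x G x] and [G x] pair to [B x y], and the
    vectors [D_y G x] fill the space. *)
Lemma derive_radial x : 'D_x G x = G x.
Proof.
have [K GK KG] : bijective ('d G x).
  by apply: isometry_bijective => // u v; rewrite -!deriveE// derive_isometry.
apply/eqP; rewrite -subr_eq0; apply/eqP; apply: nondeg => y.
rewrite -[y]KG -deriveE// linearBl /= GB derive_isometry subrr.
by [].
Qed.

Lemma rigidity_linear x : G x = 'd G 0 x.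
Proof.
rewrite -deriveE//; apply/rowP => j.
have DGj y w : 'D_w (fun z => G z 0 j) y = 'D_w G y 0 j.
  by rewrite [in RHS]derive_mx ?mxE//; exact: diff_derivable.
rewrite -DGj; apply: Euler_homogeneous => y; last by rewrite DGj derive_radial.
by have [] := Ck_coord 0 j CG.
Qed.

Lemma rigidity_isometry x y : B (G x) (G y) = B x y.
Proof. by rewrite !rigidity_linear -!deriveE// derive_isometry. Qed.

End Rigidity.
End RowSpace.

(** * Tangent maps and pullbacks in the chart *)

Section Chart.
Context {R : realType} {V : vectType R}.
Implicit Types (g h : V -> V) (z v : V).

Definition chart g (x : 'rV[R]_(dim V)) : 'rV[R]_(dim V) := v2r (g (r2v x)).

Lemma chart_comp g h : chart (h \o g) = chart h \o chart g.
Proof. by apply/funext => x; rewrite /chart /= v2rK. Qed.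

Lemma derive1_chart (F : normedModType R) (f : V -> F) z v :
  differentiable (f \o r2v) (v2r z) ->
  derive1 (fun t => f (z + t *: v)) 0 = 'D_(v2r v) (f \o r2v) (v2r z).
Proof.
move=> df; have df0 : differentiable (f \o r2v) (v2r z + 0 *: v2r v).
  by rewrite scale0r addr0.
have := @derive_val _ _ _ _ _ _ _ (is_derive_line df0).
rewrite scale0r addr0 -derive1E => <-; congr (derive1 _ 0).
by apply/funext => t /=; rewrite -linearZ -linearD v2rK.
Qed.

Lemma smooth_differentiable g x : smooth g -> differentiable (chart g) x.
Proof. by move=> /(_ 1) []. Qed.

Lemma tangent_mapE g z v : smooth g ->
  tangent_map g z v = r2v ('D_(v2r v) (chart g) (v2r z)).
Proof.
move=> sg; rewrite /tangent_map (@derive1_chart _ (v2r \o g))//.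
exact: smooth_differentiable.
Qed.

Lemma smooth_comp g h : smooth g -> smooth h -> smooth (h \o g).
Proof.
by move=> sg sh k; have := Ck_comp (sh k) (sg k); rewrite -chart_comp.
Qed.

Lemma tangent_map_comp g h z v : smooth g -> smooth h ->
  tangent_map (h \o g) z v = tangent_map h (g z) (tangent_map g z v).
Proof.
move=> sg sh.
rewrite (tangent_mapE z v (smooth_comp sg sh)) (tangent_mapE z v sg).
rewrite (tangent_mapE _ _ sh).
rewrite chart_comp derive_comp; [|exact: smooth_differentiable..].
by rewrite r2vK /chart v2rK.
Qed.

Lemma Iso_comp eta1 eta2 eta3 g h :
  Iso eta1 eta2 g -> Iso eta2 eta3 h -> Iso eta1 eta3 (h \o g).
Proof.
move=> [sg ge] [sh he]; split; first exact: smooth_comp.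
rewrite -ge -he; apply/funext => z; apply/funext => v.
by rewrite /pullback tangent_map_comp.
Qed.

Lemma chart_linear g : linear g -> linear (chart g).
Proof. by move=> ling k x y; rewrite /chart linearP ling linearP. Qed.

Lemma smooth_linear g : linear g -> smooth g.
Proof. by move=> ling k; exact/Ck_linear_row/chart_linear. Qed.

Lemma tangent_map_linear g z v : linear g -> tangent_map g z v = g v.
Proof.
move=> ling; rewrite tangent_mapE; last exact: smooth_linear.
by rewrite derive_linear_row ?/chart ?v2rK//; exact: chart_linear.
Qed.

End Chart.

(** * Isomorphisms of Liouville forms *)

Section Symplectic.
Context {R : realType} {V : vectType R} {Omega : {biscalar V}}.
Hypothesis hOmega : symplectic Omega.

Let rowOmega (x y : 'rV[R]_(dim V)) : R := Omega (r2v x) (r2v y).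

Let rowOmega_bilinear : bilinear_for (GRing.Scale.Law.clone _ _ *%R _)
  (GRing.Scale.Law.clone _ _ *%R _) rowOmega.
Proof.
by split=> [u'|u] a x y; rewrite /rowOmega linearP (linearPl, linearPr).
Qed.

(* [Omega] in the chart, as a bilinear form on row vectors. *)
Let B : {biscalar 'rV[R]_(dim V)} :=
  HB.pack rowOmega (bilinear_isBilinear.Build _ _ _ _ _ _ _ rowOmega_bilinear).

Lemma Iso_liouville : Iso (liouville Omega) (liouville Omega) = Sp Omega.
Proof.
apply/seteqP; split => g.
  move=> [sg Hg].
  have altB x : B x x = 0 by exact: hOmega.1.
  have nondegB x : (forall y, B x y = 0) -> x = 0.
    move=> Bx0; apply: (can_inj r2vK); rewrite linear0; apply: hOmega.2 => y.
    by rewrite -[y]v2rK; exact: Bx0.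
  have GB x v : B (chart g x) ('D_v (chart g) x) = B x v.
    have := congr1 (fun f => f (r2v x) (r2v v)) Hg.
    rewrite /pullback /liouville tangent_mapE// !r2vK.
    move=> /mulfI; rewrite /B /= /rowOmega /chart v2rK; apply.
    by rewrite invr_neq0.
  have CG := sg 2%N.
  have gE z : g z = r2v ('d (chart g) 0 (v2r z)).
    by rewrite -(rigidity_linear altB nondegB CG GB) /chart !v2rK.
  have iso := rigidity_isometry altB nondegB CG GB.
  have [K GK KG] : bijective (chart g).
    have -> : chart g = 'd (chart g) 0.
      by apply/funext; exact: rigidity_linear.
    apply: (isometry_bijective nondegB) => x y.
    by rewrite -!(rigidity_linear altB nondegB CG GB).
  split.
  - by move=> a x y; rewrite !gE !linearP.
  - exists (r2v \o K \o v2r) => z /=.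
      by have := GK (v2r z); rewrite /chart v2rK => ->; rewrite v2rK.
    by have := KG (v2r z); rewrite /chart => /(can_inj v2rK).
  - by move=> x y; have := iso (v2r x) (v2r y); rewrite /= /rowOmega /chart !v2rK.
move=> [lin_g _ isog].
split; first exact: smooth_linear.
apply/funext => z; apply/funext => v.
by rewrite /pullback /liouville tangent_map_linear// isog.
Qed.

Section Shearing.
Variables (n : nat) (a : V).

(** [c = 1/n] gives the shear and [c = -1/n] its inverse, so that one computation
    serves for both. *)
Definition shearing (c : R) (z : V) : V := z + (c * Omega a z ^+ n.+1) *: a.

Lemma shearE : shear Omega n a = shearing n%:R^-1.
Proof. by []. Qed.

Lemma shear_invE : shear_inv Omega n a = shearing (- n%:R^-1).
Proof. by apply/funext => z; rewrite /shearing mulNr scaleNr. Qed.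

(* The linear form [Omega a] in the chart. *)
Let ell (x : 'rV[R]_(dim V)) : R := Omega a (r2v x).
Let ell_linear : linear ell.
Proof. by move=> k x y; rewrite /ell linearP linearPr. Qed.
Let ell_Ck k : Ck k ell := Ck_linear_row k ell_linear.
Let ell_diff x : differentiable ell x := linear_row_differentiable x ell_linear.

Let derive_ell_exp c k x v :
  'D_v (fun y => c * ell y ^+ k.+1) x = c * (k.+1%:R * ell x ^+ k * ell v).
Proof.
have dl : is_derive x v ell (ell v).
  by split; [exact: diff_derivable|exact: derive_linear_row].
have /@derive_val := is_deriveZ c (is_deriveX k.+1 dl).
rewrite /GRing.scale /= => <-.
apply: (congr1 (fun f => derive f x v)); apply/funext => y.
by rewrite exprfctE.
Qed.

Let Ck_ell_exp c k j : Ck j (fun y => c * ell y ^+ k).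
Proof. by apply: CkZ; [exact: Ck_cst|exact: CkX]. Qed.

Lemma smooth_shearing c : smooth (shearing c).
Proof.
move=> k.
have -> : (fun x => v2r (shearing c (r2v x))) =
    fun x => x + (c * ell x ^+ n.+1) *: v2r a.
  by apply/funext => x; rewrite /shearing linearD linearZ /= r2vK.
apply: CkD; first exact: Ck_linear_row.
by apply: CkZ; [exact: Ck_ell_exp|exact: Ck_cst].
Qed.

Lemma tangent_map_shearing c z v : tangent_map (shearing c) z v =
  v + (c * (n.+1%:R * Omega a z ^+ n * Omega a v)) *: a.
Proof.
rewrite tangent_mapE; last exact: smooth_shearing.
have -> : chart (shearing c) = fun x => x + (c * ell x ^+ n.+1) *: v2r a.
  by apply/funext => x; rewrite /chart /shearing linearD linearZ /= r2vK.
have dk : differentiable (fun y => c * ell y ^+ n.+1) (v2r z).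
  by have [] := Ck_ell_exp c n.+1 1.
rewrite deriveD; [|exact: derivable_id|]; last first.
  exact/diff_derivable/differentiableZl.
rewrite derive_id (derive_bilinear (@scale_bilinear _ _) (@scale_continuous _ _))//.
rewrite derive_cst scaler0 add0r derive_ell_exp /ell linearD linearZ /= !v2rK.
by [].
Qed.

Lemma differential_psi z v :
  differential (psi Omega n a) z v = 2^-1 * (Omega a z ^+ n.+1 * Omega a v).
Proof.
rewrite /differential (@derive1_chart _ _ _ (psi Omega n a)); last first.
  by have [] := Ck_ell_exp (2 * n.+2%:R)^-1 n.+2 1.
by rewrite [LHS]derive_ell_exp /ell !v2rK invfM -!mulrA mulKf// pnatr_eq0.
Qed.

Lemma Omega_addZ k x : Omega a (x + k *: a) = Omega a x.
Proof. by rewrite linearDr linearZr_LR /= hOmega.1 mulr0 addr0. Qed.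

(** The variation of the perturbation contributes -c(n+1), by skew-symmetry, and
    the perturbation itself contributes c, both times
    [Omega(a,z)^(n+1) Omega(a,v) / 2 = d psi]. *)
Lemma liouville_shearing c z v :
  liouville Omega (shearing c z) (tangent_map (shearing c) z v) =
  liouville Omega z v - n%:R * c * differential (psi Omega n a) z v.
Proof.
rewrite differential_psi tangent_map_shearing /liouville /shearing.
have OmegaZl k x y : Omega (k *: x) y = k * Omega x y by rewrite linearZl_LR.
have OmegaZr k x y : Omega x (k *: y) = k * Omega x y by rewrite linearZr_LR.
rewrite linearDr !linearDl /= !OmegaZr !OmegaZl hOmega.1.
rewrite (alternating_skew hOmega.1 a z) -[n.+1%:R]natr1 exprS.
ring.
Qed.

Lemma differential_psi_shearing c z v :
  differential (psi Omega n a) (shearing c z) (tangent_map (shearing c) z v) =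
  differential (psi Omega n a) z v.
Proof.
by rewrite !differential_psi tangent_map_shearing !Omega_addZ.
Qed.

Hypothesis hn : (0 < n)%N.

Let nN0 : n%:R != 0 :> R. Proof. by rewrite pnatr_eq0 -lt0n. Qed.

(** For [c = 1/n] the pullback of [theta] is [theta - d psi], and [d psi] is
    invariant. *)
Lemma Iso_shear :
  Iso (liouville Omega) (liouville_at Omega n a) (shear Omega n a).
Proof.
rewrite shearE; split; first exact: smooth_shearing.
apply/funext => z; apply/funext => v; rewrite /pullback /liouville_at.
rewrite liouville_shearing differential_psi_shearing mulfV//; ring.
Qed.

Lemma Iso_shear_inv :
  Iso (liouville_at Omega n a) (liouville Omega) (shear_inv Omega n a).
Proof.
rewrite shear_invE; split; first exact: smooth_shearing.
apply/funext => z; apply/funext => v; rewrite /pullback /liouville_at.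
rewrite liouville_shearing mulrN mulfV//; ring.
Qed.

End Shearing.
End Symplectic.

Theorem mainTheorem9 (R : realType) (V : vectType R) (Omega : {biscalar V})
    (hOmega : symplectic Omega) (n : nat) (hn : (0 < n)%N) (a b : V) :
  Iso (liouville_at Omega n a) (liouville_at Omega n b) =
  [set shear Omega n b \o gamma \o shear_inv Omega n a | gamma in Sp Omega].
Proof.
apply/seteqP; split => g.
  move=> Hg; exists (shear_inv Omega n b \o g \o shear Omega n a).
    rewrite -(Iso_liouville hOmega).
    apply: Iso_comp (Iso_shear hOmega a hn) _.
    exact: Iso_comp Hg (Iso_shear_inv hOmega b hn).
  by apply/funext => z; rewrite /= !shear_invK.
move=> [gamma]; rewrite -(Iso_liouville hOmega) => Hgamma <-.
apply: Iso_comp (Iso_shear_inv hOmega a hn) _.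
exact: Iso_comp Hgamma (Iso_shear hOmega b hn).
Qed.
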